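(* Let $d \ge 2$ be an integer. For any vector $w \in \mathbb{R}^d$ and any bias term $b \in \mathbb{R}$ there exists a $d$-dimensional tensor $\mathcal{W} \in \mathbb{R}^{2 \times \cdots \times 2}$ of TT-rank $2$ such that for any vector $x \in \mathbb{R}^d$ with corresponding object-tensor $\mathcal{X}$, defined by $\mathcal{X}_{i_1 \ldots i_d} = \prod_{k=1}^d x_k^{i_k}$ for $(i_1,\ldots,i_d) \in \{0,1\}^d$, $$\langle \mathcal{X}, \mathcal{W} \rangle = \langle x, w \rangle + b.$$
   Context: Convention: $0^0 = 1$. The dot product of two tensors of size $2 \times \cdots \times 2$ is $\langle \mathcal{X}, \mathcal{W} \rangle = \sum_{i_1=0}^1 \cdots \sum_{i_d=0}^1 \mathcal{X}_{i_1 \ldots i_d} \mathcal{W}_{i_1 \ldots i_d}$, and $\langle x, w\rangle = \sum_{k=1}^d x_k w_k$. TT-rank: a $d$-dimensional tensor $\mathcal{A}$ of size $2 \times \cdots \times 2$, with indices $i_k \in \{0,1\}$, is represented in the Tensor Train (TT) format with TT-rank $r$ if each of its elements is given as $\mathcal{A}_{i_1 \ldots i_d} = G_1[i_1] G_2[i_2] \cdots G_d[i_d]$, where for each value of the indices $G_1[i_1]$ is a $1 \times r$ real row vector, $G_k[i_k]$ is an $r \times r$ real matrix for $k = 2, \ldots, d-1$, and $G_d[i_d]$ is an $r \times 1$ real column vector. ''A tensor of TT-rank $r$'' means a tensor that admits such a representation with slices of size $r$; minimality of $r$ is not part of the definition. *)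

(* Defs.v *)
From HB Require Import structures.
From mathcomp Require Import all_boot all_order all_algebra.
From mathcomp Require Import reals.

Set Implicit Arguments.
Unset Strict Implicit.
Unset Printing Implicit Defensive.

Import GRing.Theory.
Local Open Scope ring_scope.

(* Positions are numbered 0, ..., d-1 instead of 1, ..., d. *)
Definition tensor_index (d : nat) := {ffun 'I_d -> 'I_2}.

Definition tensor (R : realType) (d : nat) := {ffun tensor_index d -> R}.

Definition tensor_dot (R : realType) (d : nat) (X W : tensor R d) : R :=
  \sum_(i : tensor_index d) X i * W i.

Definition vector_dot (R : realType) (d : nat) (x w : 'rV[R]_d) : R :=
  \sum_(k < d) x 0 k * w 0 k.

(* The convention 0^0 = 1 is the library's: x ^+ 0 = 1 for every x. *)
Definition object_tensor (R : realType) (d : nat) (x : 'rV[R]_d) : tensor R d :=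
  [ffun i : tensor_index d => \prod_(k < d) x 0 k ^+ i k].

Definition first_pos (d : nat) (hd : (2 <= d)%N) : 'I_d := Ordinal (ltnW hd).

Lemma last_pos_subproof (d : nat) (hd : (2 <= d)%N) : (d.-1 < d)%N.
Proof. by rewrite ltn_predL ltnW. Qed.

Definition last_pos (d : nat) (hd : (2 <= d)%N) : 'I_d :=
  Ordinal (last_pos_subproof hd).

(* A admits a TT representation with slices of size r (r need not be minimal).
   The family G is indexed by all of 'I_d, but only the slices at the strictly
   interior positions are used; the matrix product is in increasing order of
   the position and is the identity when d = 2. *)
Definition has_TT_rank (R : realType) (d : nat) (hd : (2 <= d)%N) (r : nat)
    (A : tensor R d) : Prop :=
  exists (Gfirst : 'I_2 -> 'rV[R]_r) (G : 'I_d -> 'I_2 -> 'M[R]_r)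
         (Glast : 'I_2 -> 'cV[R]_r),
  forall i : tensor_index d,
    A i = (Gfirst (i (first_pos hd))
           *m \big[mulmx/1%:M]_(k < d | (0 < k < d.-1)%N) G k (i k)
           *m Glast (i (last_pos hd))) 0 0.

(* Main.v *)
Require Import Defs.
From HB Require Import structures.
From mathcomp Require Import all_boot all_order all_algebra.
From mathcomp Require Import reals.

Set Implicit Arguments.
Unset Strict Implicit.
Unset Printing Implicit Defensive.

Import GRing.Theory.
Local Open Scope ring_scope.

(** Take [W_i = e_0 M_1(i_1) ... M_d(i_d) (b, 1)^T] with [M_k(0) = 1] and
    [M_k(1) = w_k N], where [N] is the nilpotent matrix unit [E_01].  Absorbing
    the row and the column into the end slices gives TT-rank 2.  Contracting
    with the rank-one tensor [X] distributes over the product and yields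
    [e_0 (\prod_k (1 + x_k w_k N)) (b, 1)^T]; since [N^2 = 0], the product is
    [1 + <x, w> N]. *)

(** Brings a full ordered product into the shape required by [has_TT_rank]. A plain monoid law is
    assumed because matrix multiplication does not commute. *)
Lemma big_ord_ends (T : Type) (idx : T) (op : Monoid.law idx) (d : nat)
    (hd : (2 <= d)%N) (F : 'I_d -> T) :
  \big[op/idx]_(k < d) F k =
  op (op (F (first_pos hd)) (\big[op/idx]_(k < d | (0 < k < d.-1)%N) F k))
     (F (last_pos hd)).
Proof.
case: d hd F => [|[|n]] // hd F.
have -> : first_pos hd = ord0 by apply: val_inj.
have -> : last_pos hd = lift ord0 ord_max by apply: val_inj.
(* With the filter moved into the factors, both end factors become [idx] and the interior ones are
   unchanged. *)
rewrite [in RHS]big_mkcond big_ord_recl big_ord_recr [in RHS]big_ord_recl.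
rewrite [in RHS]big_ord_recr /= ltnn Monoid.mul1m Monoid.mulm1 Monoid.mulmA.
by congr (op (op _ _) _); apply: eq_bigr => k _; rewrite /bump /= add1n ltnS ltn_ord.
Qed.

Lemma prod_1D_nilp (S : comNzRingType) (A : algType S) (N : A) (I : Type)
    (r : seq I) (P : pred I) (a : I -> S) :
  N * N = 0 ->
  \prod_(k <- r | P k) (1 + a k *: N) = 1 + (\sum_(k <- r | P k) a k) *: N.
Proof.
move=> N2; elim/big_rec2: _ => [|k y x _ ->]; first by rewrite scale0r addr0.
rewrite mulrDl mul1r mulrDr mulr1 -scalerAl -scalerAr N2 !scaler0 addr0.
by rewrite scalerDl -addrA [_ *: N + _]addrC.
Qed.

Theorem theorem2 (R : realType) (d : nat) (hd : (2 <= d)%N)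
    (w : 'rV[R]_d) (b : R) :
  exists W : tensor R d,
    has_TT_rank hd 2 W /\
    forall x : 'rV[R]_d,
      tensor_dot (object_tensor x) W = vector_dot x w + b.
Proof.
pose N : 'M[R]_2 := delta_mx 0 1.
pose e : 'rV[R]_2 := delta_mx 0 0.
pose c : 'cV[R]_2 := b *: delta_mx 0 0 + delta_mx 1 0.
pose M (k : 'I_d) (j : 'I_2) : 'M[R]_2 := if j == 0 then 1 else w 0 k *: N.
exists [ffun i : tensor_index d => (e *m (\prod_k M k (i k)) *m c) 0 0].
split=> [|x].
  exists (fun j => e *m M (first_pos hd) j), M, (fun j => M (last_pos hd) j *m c).
  by move=> i; rewrite ffunE big_ord_ends !mulmxA.
have N2 : N * N = 0 by apply: mul_delta_mx_0.
transitivity ((e *m (\prod_(k < d) (1 + (x 0 k * w 0 k) *: N)) *m c) 0 0); last first.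
  (* Row 0 of the product is $(1, \langle x, w\rangle)$; paired with [c], that is $(b, 1)^T$, it
     gives the affine value. *)
  rewrite prod_1D_nilp // -/(vector_dot x w) [e *m _]mulmxDr mulmx1 mulmxDl -scalemxAr.
  rewrite mul_delta_mx -scalemxAl !mulmxDr -!scalemxAr !mul_delta_mx.
  rewrite !mul_delta_mx_0 // !scaler0 addr0 add0r !mxE /=.
  by rewrite !mulr1 addrC.
(* Each factor is a sum over one index [j], with $x_k^0 = 1$ in front of [M k 0 = 1]; expanding the
   product then yields one term per multi-index. *)
have -> : \prod_(k < d) (1 + (x 0 k * w 0 k) *: N) =
    \prod_(k < d) \sum_(j < 2) x 0 k ^+ j *: M k j.
  by apply: eq_bigr => k _; rewrite 2!big_ord_recl big_ord0 /= scale1r addr0 scalerA.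
rewrite bigA_distr_bigA mulmx_sumr mulmx_suml summxE; apply: eq_bigr => i _.
by rewrite !ffunE scaler_prod -scalemxAr -scalemxAl [RHS]mxE.
Qed.
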